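(* Let $M=(M_1,M_2)$ with $M_1,M_2\subsetneq\mathbb{R}$ neutrices. Let $X\subseteq\mathbb{R}^2$, let $a=(a_1,a_2)\in X$ be an $M$-interior point of $X$ and let $F:X\to\mathbb{E}$ be a flexible function which is $M_1$-partial differentiable in the first variable and $M_2$-partial differentiable in the second variable at $a$. Let $L$ be a neutrix which is stable for $\min\{M_1,M_2\}$ and such that $$L\supseteq\max\left(\mathrm{N}(F(a)),\ \mathrm{N}\left(\frac{\partial F}{\partial_{M_1}x_1}(a)\right),\ \mathrm{N}\left(\frac{\partial F}{\partial_{M_2}x_2}(a)\right)\right).$$ If $a$ is an $M$-local $L$-extreme point of $F$, then $\frac{\partial F}{\partial_{M_i}x_i}(a)\subseteq L$ for $i\in\{1,2\}$.
   Context: Setting: Nelson's Internal Set Theory IST, together with external sets (in the sense of Kanovei and Reeken). External numbers. A (scalar) neutrix is a (possibly external) convex additive subgroup of $\mathbb{R}$; by convention all neutrices are different from $\mathbb{R}$; neutrices are totally ordered by inclusion, and max, min refer to inclusion. An external number is a set $\alpha=a+A=\{a+x: x\in A\}$ with $a\in\mathbb{R}$ and $A$ a neutrix; $\mathrm{N}(\alpha)=A$ is its neutrix part. $\mathbb{E}$ is the class of external numbers; real numbers ($A=\{0\}$) and neutrices are external numbers. For $\alpha=a+A,\beta=b+B$: $\alpha\pm\beta=a\pm b+\max\{A,B\}$, $\alpha\beta=ab+\max\{aB,bA,AB\}$; for a non-zero real $h$, $\alpha/h=a/h+A/h$. $|\alpha|=|a|+A$. Order: $\alpha\le\beta$ iff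 $\forall s\in\alpha\,\exists t\in\beta\,(s\le t)$; $\alpha\ge\beta$ iff $\forall s\in\alpha\,\exists t\in\beta\,(s\ge t)$; $\alpha<\beta$ (equivalently $\beta>\alpha$) iff $s<t$ for all $s\in\alpha,t\in\beta$; in particular, for real $r$ and a neutrix $K$, $r>K$ means that $r$ exceeds all elements of $K$. An absorber of a neutrix $L$ is a real $r$ with $rL\subsetneq L$. A neutrix $L$ is stable for a neutrix $K$ if $K$ contains all absorbers of $L$ (so that $L/h\subseteq L$ for all $h\notin K$). Flexible functions. A flexible function is a map $F:X\to\mathbb{E}$ whose graph is definable in IST; it is assumed to have a (not necessarily internal) representative $f:X\to\mathbb{R}$, so $F(x)=f(x)+\mathrm{N}(F(x))$. Neighborhoods. An $M$-neighborhood of $a+M=(a_1+M_1,a_2+M_2)$ is an internal set $U\subseteq\mathbb{R}^2$ containing $(a_1-r_1,a_1+r_1)\times(a_2-r_2,a_2+r_2)$ for some reals $r_1>M_1,r_2>M_2$; $a$ is an $M$-interior point of $X$ if $X$ contains an $M$-neighborhood of $a+M$. Outer limits. For neutrices $K,P$ and $c\in\mathbb{R}$, $\alpha\in\mathbb{E}$ satisfies $K\text{-}\lim_{x\to c+P}H(x)=\alpha$ if for every real $\varepsilon>K$ there is $\delta>P$ such that $|H(x)-\alpha|<\varepsilon$ for all $x$ in the domain of $H$ with $P<|x-c|<\delta$. The outer limit $\lim_{x\to c+P}H(x)$ is the intersection of all $\alpha\in\mathbb{E}$ such that $\mathrm{N}(\alpha)\text{-}\lim_{x\to c+P}H(x)=\alpha$;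 it exists if there is at least one such $\alpha$, and it is then an external number. Partial derivatives. $\frac{\partial F}{\partial_{M_1}x_1}(a)=\lim_{x\to a_1+M_1}\frac{F(x,a_2)-F(a_1,a_2)}{x-a_1}$, $\frac{\partial F}{\partial_{M_2}x_2}(a)=\lim_{y\to a_2+M_2}\frac{F(a_1,y)-F(a_1,a_2)}{y-a_2}$; $F$ is $M_i$-partial differentiable in the $i$-th variable at $a$ if the corresponding outer limit exists. Local extreme points. $a$ is an $M$-local $L$-minimizer (maximizer) of $F$ if there is an $M$-neighborhood $U\subseteq X$ of $a+M$ such that $F(x)\ge F(a)+L$ (respectively $F(x)\le F(a)+L$) for all $x\in U$; an $M$-local $L$-extreme point is an $M$-local $L$-minimizer or an $M$-local $L$-maximizer. *)

(* Defs.v *)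
From mathcomp Require Import all_boot all_order all_algebra.
From mathcomp Require Import all_classical.
Set Implicit Arguments.
Unset Strict Implicit.
Unset Printing Implicit Defensive.
Import Order.TTheory GRing.Theory Num.Theory.
Local Open Scope classical_set_scope.
Local Open Scope ring_scope.

(* IST is rendered through its models: a universe of internal sets with a
   binary predicate [mem] and a unary predicate [std].  The axiom schemata range
   over (deeply embedded) formulas of the language {mem, std}; external sets
   are the subclasses of internal sets cut out by such formulas, parameters
   being allowed. *)

Structure st_universe := StUniverse {
  obj :> Type;
  mem : obj -> obj -> Prop;
  std : obj -> Prop
}.

(* Variables are de Bruijn indices. *)
Inductive formula :=
  | FMem of nat & nat
  | FEq of nat & nat
  | FStd of nat
  | FFalse
  | FImp of formula & formula
  | FAll of formula.

Fixpoint internal_formula (phi : formula) : bool :=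
  match phi with
  | FMem _ _ | FEq _ _ | FFalse => true
  | FStd _ => false
  | FImp phi1 phi2 => internal_formula phi1 && internal_formula phi2
  | FAll phi1 => internal_formula phi1
  end.

Definition scons (T : Type) (x : T) (e : nat -> T) : nat -> T :=
  fun n => if n is m.+1 then e m else x.

Fixpoint sat (V : st_universe) (e : nat -> V) (phi : formula) : Prop :=
  match phi with
  | FMem i j => mem (e i) (e j)
  | FEq i j => e i = e j
  | FStd i => std (e i)
  | FFalse => False
  | FImp phi1 phi2 => sat e phi1 -> sat e phi2
  | FAll phi1 => forall x : V, sat (scons x e) phi1
  end.

Definition is_upair (V : st_universe) (x y z : V) : Prop :=
  forall w : V, mem w z <-> w = x \/ w = y.

(* Kuratowski pairs, and triples ((x, y), z). *)
Definition is_pair (V : st_universe) (x y p : V) : Prop :=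
  exists s d : V, [/\ is_upair x x s, is_upair x y d & is_upair s d p].

Definition is_triple (V : st_universe) (x y z t : V) : Prop :=
  exists2 p : V, is_pair x y p & is_pair p z t.

Definition subobj (V : st_universe) (x y : V) : Prop :=
  forall z : V, mem z x -> mem z y.

(* Finiteness in the sense of the internal universe, in Tarski's form: every
   nonempty family of subsets of [x] has an inclusion-maximal element. *)
Definition internally_finite (V : st_universe) (x : V) : Prop :=
  forall f : V, (exists u : V, mem u f) ->
    (forall u : V, mem u f -> subobj u x) ->
    exists2 m : V, mem m f & forall u : V, mem u f -> subobj m u -> u = m.

Record ZFC (V : st_universe) : Prop := {
  zfc_extensionality : forall x y : V,
    (forall z : V, mem z x <-> mem z y) -> x = y;
  zfc_foundation : forall x : V, (exists y : V, mem y x) ->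
    exists2 y : V, mem y x & forall z : V, mem z y -> ~ mem z x;
  zfc_pairing : forall x y : V, exists z : V, is_upair x y z;
  zfc_union : forall x : V, exists y : V, forall z : V,
    mem z y <-> exists2 u : V, mem u x & mem z u;
  zfc_powerset : forall x : V, exists y : V, forall z : V,
    mem z y <-> subobj z x;
  zfc_infinity : exists w : V,
    (exists2 o : V, mem o w & forall z : V, ~ mem z o) /\
    (forall x : V, mem x w ->
       exists2 y : V, mem y w & forall z : V, mem z y <-> mem z x \/ z = x);
  zfc_separation : forall (phi : formula) (e : nat -> V) (x : V),
    internal_formula phi ->
    exists y : V, forall z : V, mem z y <-> mem z x /\ sat (scons z e) phi;
  zfc_replacement : forall (phi : formula) (e : nat -> V) (x : V),
    internal_formula phi ->
    (forall u : V, mem u x -> exists! v : V, sat (scons u (scons v e)) phi) ->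
    exists y : V, forall v : V,
      mem v y <-> exists2 u : V, mem u x & sat (scons u (scons v e)) phi;
  zfc_choice : forall x : V,
    (forall y : V, mem y x -> exists z : V, mem z y) ->
    (forall y y' z : V, mem y x -> mem y' x -> mem z y -> mem z y' -> y = y') ->
    exists c : V, forall y : V, mem y x ->
      exists! z : V, mem z y /\ mem z c
}.

Record IST (V : st_universe) : Prop := {
  ist_zfc : ZFC V;
  ist_transfer : forall (phi : formula) (e : nat -> V),
    internal_formula phi -> (forall n : nat, std (e n)) ->
    (forall x : V, std x -> sat (scons x e) phi) ->
    forall x : V, sat (scons x e) phi;
  ist_idealization : forall (phi : formula) (e : nat -> V),
    internal_formula phi ->
    (forall z : V, std z -> internally_finite z ->
       exists x : V, forall y : V, mem y z -> sat (scons x (scons y e)) phi) <->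
    (exists x : V, forall y : V, std y -> sat (scons x (scons y e)) phi);
  ist_standardization : forall (phi : formula) (e : nat -> V) (x : V), std x ->
    exists2 y : V, std y &
      forall z : V, std z -> (mem z y <-> mem z x /\ sat (scons z e) phi)
}.

(* [R] is, through [incl], the field of real numbers of the universe [V]: its
   carrier, operations and order are standard sets, and it is complete with
   respect to internal sets. *)
Record is_real_field (V : st_universe) (R : realFieldType) (incl : R -> V)
    : Prop := {
  incl_inj : injective incl;
  incl_carrier : exists2 r : V, std r &
    forall v : V, mem v r <-> exists x : R, v = incl x;
  incl_add : exists2 g : V, std g & forall v : V, mem v g <->
    exists x y : R, is_triple (incl x) (incl y) (incl (x + y)) v;
  incl_mul : exists2 g : V, std g & forall v : V, mem v g <->
    exists x y : R, is_triple (incl x) (incl y) (incl (x * y)) v;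
  incl_le : exists2 g : V, std g & forall v : V, mem v g <->
    exists x y : R, x <= y /\ is_pair (incl x) (incl y) v;
  incl_complete : forall s : V, (exists x : R, mem (incl x) s) ->
    (exists b : R, forall x : R, mem (incl x) s -> x <= b) ->
    exists2 l : R, (forall x : R, mem (incl x) s -> x <= l) &
      forall b : R, (forall x : R, mem (incl x) s -> x <= b) -> l <= b
}.

Structure ist_model := IstModel {
  universe : st_universe;
  universe_IST : IST universe;
  reals :> realFieldType;
  incl : reals -> universe;
  inclP : is_real_field incl
}.

(* [code t] lists the internal sets coding [t]; they are the values of the
   first variables of the defining formula, the others being parameters. *)
Definition definable (V : st_universe) (T : Type) (code : T -> seq V)
    (S : set T) : Prop :=
  exists (phi : formula) (e : nat -> V),
    forall t : T, S t <-> sat (foldr (@scons V) e (code t)) phi.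

Definition external (R : ist_model) (S : set R) : Prop :=
  definable (fun x : R => [:: incl x]) S.

Definition external2 (R : ist_model) (S : set (R * R)) : Prop :=
  definable (fun x : R * R => [:: incl x.1; incl x.2]) S.

Definition external3 (R : ist_model) (S : set (R * R * R)) : Prop :=
  definable (fun x : R * R * R => [:: incl x.1.1; incl x.1.2; incl x.2]) S.

Definition internal2 (R : ist_model) (S : set (R * R)) : Prop :=
  exists u : universe R, forall x : R * R,
    S x <-> exists2 p : universe R, is_pair (incl x.1) (incl x.2) p & mem p u.

Definition convex_subgroup (R : realFieldType) (A : set R) : Prop :=
  [/\ A 0,
      forall x y : R, A x -> A y -> A (x - y) &
      forall x y z : R, A x -> A y -> x <= z -> z <= y -> A z].

Definition neutrix (R : ist_model) (A : set R) : Prop :=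
  [/\ external A, convex_subgroup A & A <> setT].

(* Maximum and minimum with respect to inclusion. *)
Definition nmax (R : realFieldType) (A B : set R) : set R :=
  if `[< A `<=` B >] then B else A.

Definition nmin (R : realFieldType) (A B : set R) : set R :=
  if `[< A `<=` B >] then A else B.

Definition coset (R : realFieldType) (a : R) (A : set R) : set R :=
  [set a + x | x in A].

Definition external_number (R : ist_model) (alpha : set R) : Prop :=
  exists (a : R) (A : set R), neutrix A /\ alpha = coset a A.

(* The neutrix part is recovered from an external number as its set of
   differences, see [npart_coset]; [rep alpha] is a chosen element of [alpha].
   By the lemmas [ext_addE] to [ext_divE] the operations below do not depend on
   that choice and are given by the usual formulas. *)
Definition npart (R : realFieldType) (alpha : set R) : set R :=
  [set z | exists x y : R, [/\ alpha x, alpha y & z = x - y]].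

Definition rep (R : realFieldType) (alpha : set R) : R := xget 0 alpha.

Definition ext_add (R : realFieldType) (alpha beta : set R) : set R :=
  coset (rep alpha + rep beta) (nmax (npart alpha) (npart beta)).

Definition ext_sub (R : realFieldType) (alpha beta : set R) : set R :=
  coset (rep alpha - rep beta) (nmax (npart alpha) (npart beta)).

Definition ext_abs (R : realFieldType) (alpha : set R) : set R :=
  coset `|rep alpha| (npart alpha).

Definition ext_div (R : realFieldType) (alpha : set R) (h : R) : set R :=
  coset (rep alpha / h) [set x / h | x in npart alpha].

Definition ext_le (R : realFieldType) (alpha beta : set R) : Prop :=
  forall s : R, alpha s -> exists2 t : R, beta t & s <= t.

(* Not the converse of [ext_le]. *)
Definition ext_ge (R : realFieldType) (alpha beta : set R) : Prop :=
  forall s : R, alpha s -> exists2 t : R, beta t & s >= t.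

Definition ext_lt (R : realFieldType) (alpha beta : set R) : Prop :=
  forall s t : R, alpha s -> beta t -> s < t.

Definition absorber (R : realFieldType) (L : set R) (r : R) : Prop :=
  [set r * x | x in L] `<` L.

Definition stable_for (R : realFieldType) (L K : set R) : Prop :=
  forall r : R, absorber L r -> K r.

(* A flexible function with domain [X] is given by a total function into sets
   of reals, of which only the values on [X] matter. *)

Definition flexible (R : ist_model) (X : set (R * R)) (F : R * R -> set R)
    : Prop :=
  [/\ forall x : R * R, X x -> external_number (F x),
      external3 [set z : R * R * R | X z.1 /\ F z.1 z.2] &
      exists2 f : R * R -> R,
        external3 [set z : R * R * R | X z.1 /\ z.2 = f z.1] &
        forall x : R * R, X x -> F x = coset (f x) (npart (F x))].

Definition nbhd (R : ist_model) (M1 M2 : set R) (a : R * R)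
    (U : set (R * R)) : Prop :=
  internal2 U /\
  exists r1 r2 : R,
    [/\ ext_lt M1 [set r1], ext_lt M2 [set r2] &
        forall x : R * R, a.1 - r1 < x.1 < a.1 + r1 ->
          a.2 - r2 < x.2 < a.2 + r2 -> U x].

Definition interior_point (R : ist_model) (M1 M2 : set R) (X : set (R * R))
    (a : R * R) : Prop :=
  exists2 U : set (R * R), nbhd M1 M2 a U & U `<=` X.

(* K-lim_{x -> c + P} H(x) = alpha, for H with domain D *)
Definition is_klim (R : ist_model) (K : set R) (D : set R) (H : R -> set R)
    (c : R) (P : set R) (alpha : set R) : Prop :=
  forall eps : R, ext_lt K [set eps] ->
    exists2 delta : R, ext_lt P [set delta] &
      forall x : R, D x -> ext_lt P [set `|x - c|] -> `|x - c| < delta ->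
        ext_lt (ext_abs (ext_sub (H x) alpha)) [set eps].

(* [outer_lim] below is meaningful only under [has_outer_lim]. *)
Definition limit_values (R : ist_model) (D : set R) (H : R -> set R)
    (c : R) (P : set R) : set (set R) :=
  [set alpha : set R |
    external_number alpha /\ is_klim (npart alpha) D H c P alpha].

Definition has_outer_lim (R : ist_model) (D : set R) (H : R -> set R)
    (c : R) (P : set R) : Prop :=
  exists alpha : set R, limit_values D H c P alpha.

Definition outer_lim (R : ist_model) (D : set R) (H : R -> set R)
    (c : R) (P : set R) : set R :=
  \bigcap_(alpha in limit_values D H c P) alpha.

Definition domain1 (R : ist_model) (X : set (R * R)) (a : R * R) : set R :=
  [set x | X (x, a.2) /\ x <> a.1].

Definition domain2 (R : ist_model) (X : set (R * R)) (a : R * R) : set R :=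
  [set y | X (a.1, y) /\ y <> a.2].

Definition quotient1 (R : ist_model) (F : R * R -> set R) (a : R * R) (x : R)
    : set R :=
  ext_div (ext_sub (F (x, a.2)) (F a)) (x - a.1).

Definition quotient2 (R : ist_model) (F : R * R -> set R) (a : R * R) (y : R)
    : set R :=
  ext_div (ext_sub (F (a.1, y)) (F a)) (y - a.2).

Definition partial_differentiable1 (R : ist_model) (M1 : set R)
    (X : set (R * R)) (F : R * R -> set R) (a : R * R) : Prop :=
  has_outer_lim (domain1 X a) (quotient1 F a) a.1 M1.

Definition partial_differentiable2 (R : ist_model) (M2 : set R)
    (X : set (R * R)) (F : R * R -> set R) (a : R * R) : Prop :=
  has_outer_lim (domain2 X a) (quotient2 F a) a.2 M2.

Definition partial1 (R : ist_model) (M1 : set R)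
    (X : set (R * R)) (F : R * R -> set R) (a : R * R) : set R :=
  outer_lim (domain1 X a) (quotient1 F a) a.1 M1.

Definition partial2 (R : ist_model) (M2 : set R)
    (X : set (R * R)) (F : R * R -> set R) (a : R * R) : set R :=
  outer_lim (domain2 X a) (quotient2 F a) a.2 M2.

Definition local_minimizer (R : ist_model) (M1 M2 L : set R)
    (X : set (R * R)) (F : R * R -> set R) (a : R * R) : Prop :=
  exists U : set (R * R),
    [/\ nbhd M1 M2 a U, U `<=` X &
        forall x : R * R, U x -> ext_ge (F x) (ext_add (F a) L)].

Definition local_maximizer (R : ist_model) (M1 M2 L : set R)
    (X : set (R * R)) (F : R * R -> set R) (a : R * R) : Prop :=
  exists U : set (R * R),
    [/\ nbhd M1 M2 a U, U `<=` X &
        forall x : R * R, U x -> ext_le (F x) (ext_add (F a) L)].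

Definition local_extreme_point (R : ist_model) (M1 M2 L : set R)
    (X : set (R * R)) (F : R * R -> set R) (a : R * R) : Prop :=
  local_minimizer M1 M2 L X F a \/ local_maximizer M1 M2 L X F a.

Lemma npart_coset (R : realFieldType) (a : R) (A : set R) :
  convex_subgroup A -> npart (coset a A) = A.
Proof.
move=> [A0 AB _]; apply/seteqP; split=> z /=.
  move=> [_ [_ [[x Ax <-] [y Ay <-] ->]]].
  by rewrite opprD addrACA subrr add0r; exact: AB.
move=> Az; exists (a + z), (a + 0); split; first by exists z.
  by exists 0.
by rewrite addr0 addrC addKr.
Qed.

Lemma rep_coset (R : realFieldType) (a : R) (A : set R) :
  convex_subgroup A -> exists2 x : R, A x & rep (coset a A) = a + x.
Proof.
move=> [A0 _ _]; have : coset a A (rep (coset a A)).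
  by apply: xgetPex; exists (a + 0); exists 0.
by move=> [x Ax <-]; exists x.
Qed.

Lemma convex_subgroupN (R : realFieldType) (A : set R) (x : R) :
  convex_subgroup A -> A x -> A (- x).
Proof. by move=> [A0 AB _] Ax; rewrite -sub0r; exact: AB. Qed.

Lemma convex_subgroupD (R : realFieldType) (A : set R) (x y : R) :
  convex_subgroup A -> A x -> A y -> A (x + y).
Proof.
move=> cA Ax Ay; rewrite -[y]opprK; case: (cA) => _ AB _; apply: AB => //.
exact: convex_subgroupN.
Qed.

Lemma coset_shift (R : realFieldType) (a x : R) (A : set R) :
  convex_subgroup A -> A x -> coset (a + x) A = coset a A.
Proof.
move=> cA Ax; apply/seteqP; split=> _ [y Ay <-].
  by exists (x + y); rewrite ?addrA //; exact: convex_subgroupD.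
exists (y - x); last by rewrite addrA addrAC addrK.
by case: cA => _ AB _; exact: AB.
Qed.

Lemma nmaxl (R : realFieldType) (A B : set R) : A `<=` nmax A B.
Proof. by rewrite /nmax; case: asboolP => [AB|_]; last exact: subset_refl. Qed.

Lemma nmaxr (R : realFieldType) (A B : set R) :
  convex_subgroup A -> convex_subgroup B -> B `<=` nmax A B.
Proof.
move=> cA cB; rewrite /nmax; case: asboolP => [_|/existsNP[x /not_implyP[Ax nBx]]].
  exact: subset_refl.
move=> y By; have [_ _ Ac] := cA; have [_ _ Bc] := cB.
have ylx : `|y| <= `|x|.
  rewrite leNgt; apply/negP => /ltW xly; apply: nBx.
  move: xly; rewrite ler_norml => /andP[xl xu]; apply: (Bc (- `|y|) `|y|) => //;
    by case: (ger0P y) => _; rewrite ?opprK //; exact: convex_subgroupN.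
move: ylx; rewrite ler_norml => /andP[xl xu]; apply: (Ac (- `|x|) `|x|) => //;
  by case: (ger0P x) => _; rewrite ?opprK //; exact: convex_subgroupN.
Qed.

Lemma convex_subgroup_nmax (R : realFieldType) (A B : set R) :
  convex_subgroup A -> convex_subgroup B -> convex_subgroup (nmax A B).
Proof. by rewrite /nmax; case: asboolP. Qed.

Lemma ext_addE (R : realFieldType) (a b : R) (A B : set R) :
  convex_subgroup A -> convex_subgroup B ->
  ext_add (coset a A) (coset b B) = coset (a + b) (nmax A B).
Proof.
move=> cA cB; rewrite /ext_add !npart_coset //.
have [x Ax ->] := rep_coset a cA; have [y By ->] := rep_coset b cB.
have cM := convex_subgroup_nmax cA cB.
rewrite addrACA; apply: coset_shift => //; apply: (convex_subgroupD cM).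
  exact: nmaxl.
exact: nmaxr.
Qed.

Lemma ext_subE (R : realFieldType) (a b : R) (A B : set R) :
  convex_subgroup A -> convex_subgroup B ->
  ext_sub (coset a A) (coset b B) = coset (a - b) (nmax A B).
Proof.
move=> cA cB; rewrite /ext_sub !npart_coset //.
have [x Ax ->] := rep_coset a cA; have [y By ->] := rep_coset b cB.
have cM := convex_subgroup_nmax cA cB; have [_ MB _] := cM.
rewrite opprD addrACA; apply: coset_shift => //; apply: MB.
  exact: nmaxl.
exact: nmaxr.
Qed.

Lemma ext_absE (R : realFieldType) (a : R) (A : set R) :
  convex_subgroup A -> ext_abs (coset a A) = coset `|a| A.
Proof.
move=> cA; rewrite /ext_abs npart_coset //.
have [x Ax ->] := rep_coset a cA.
rewrite -[`|a + x|](subrK `|a|) addrC; apply: coset_shift => //.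
have := ler_dist_dist (a + x) a; rewrite [a + x - a]addrAC subrr add0r ler_norml => /andP[xl xu].
have [_ _ Ac] := cA; apply: (Ac (- `|x|) `|x|) => //;
  by case: (ger0P x) => _; rewrite ?opprK //; exact: convex_subgroupN.
Qed.

Lemma ext_divE (R : realFieldType) (a h : R) (A : set R) :
  convex_subgroup A ->
  ext_div (coset a A) h = coset (a / h) [set x / h | x in A].
Proof.
move=> cA; rewrite /ext_div npart_coset //.
have [x Ax ->] := rep_coset a cA; have [_ AB _] := cA.
apply/seteqP; split=> _ [_ [y Ay <-] <-].
  exists ((x + y) / h); last by rewrite !mulrDl addrA.
  by exists (x + y) => //; exact: convex_subgroupD.
exists ((y - x) / h); first by exists (y - x) => //; exact: AB.
by rewrite -!mulrDl addrA addrAC addrK.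
Qed.

(* Main.v *)
Require Import Defs.
From mathcomp Require Import all_boot all_order all_algebra.
From mathcomp Require Import all_classical.
From mathcomp Require Import lra.
Local Open Scope classical_set_scope.

(** The argument is Fermat's: next to a minimizer the difference quotients are
    nonnegative on one side and nonpositive on the other, up to an error that
    has to be controlled by [L].

    Let [d] be an element of the partial derivative and suppose that [d] is not
    in [L].  Then [`|d| / 2] exceeds [L], because [L] is a group.  An outer limit
    is an intersection of limit values, and it need not be one of them; but
    since its neutrix part is included in [L], every [eps > L] already exceeds
    the neutrix part of one of these limit values, and this makes the difference
    quotients [eps]-close to [d] ([outer_lim_approx]).  Hence they have the sign
    of [d], and absolute value more than [`|d| / 2], at all points whose distance
    to [a] is slightly larger than the neutrix [M_i].  At a minimizer the
    increment of [F] is bounded below by an element [l] of [L]; walking a step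
    [h > M_i] in the direction where [F] decreases gives [l / h < - `|d| / 2].
    Stability keeps [l / h] in [L] ([stable_forV]), so that [`|d| / 2] is in [L]
    by convexity, a contradiction ([fermat_convex_subgroup]).  Maximizers
    reduce to minimizers by a change of sign. *)

Set Implicit Arguments.
Unset Strict Implicit.
Unset Printing Implicit Defensive.

Import Order.TTheory GRing.Theory Num.Theory.
Local Open Scope ring_scope.

(** * Convex subgroups *)

Lemma coset_center (R : realFieldType) (a : R) (A : set R) :
  convex_subgroup A -> coset a A a.
Proof. by move=> [A0 _ _]; exists 0; rewrite ?addr0. Qed.

Lemma coset0 (R : realFieldType) (A : set R) : coset 0 A = A.
Proof.
apply/seteqP; split=> [_ [x Ax <-]|x Ax]; first by rewrite add0r.
by exists x; rewrite ?add0r.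
Qed.

Lemma coset_eq (R : realFieldType) (a c : R) (A : set R) :
  convex_subgroup A -> coset a A c -> coset a A = coset c A.
Proof. by move=> cA [x Ax <-]; rewrite coset_shift. Qed.

Lemma convex_subgroup_norm (R : realFieldType) (A : set R) (x y : R) :
  convex_subgroup A -> A x -> `|y| <= `|x| -> A y.
Proof.
move=> cA Ax; have [_ _ Ac] := cA; rewrite ler_norml => /andP[yl yu].
apply: (Ac (- `|x|) `|x|) => //;
  by case: (ger0P x) => _; rewrite ?opprK //; exact: convex_subgroupN.
Qed.

Lemma convex_subgroup_lt (R : realFieldType) (A : set R) (e : R) :
  convex_subgroup A -> 0 < e -> ~ A e -> ext_lt A [set e].
Proof.
move=> cA e0 nAe s _ As ->; rewrite ltNge; apply/negP => es; apply: nAe.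
apply: (convex_subgroup_norm cA As).
by rewrite !ger0_norm // ?(ltW e0) // (le_trans (ltW e0)).
Qed.

Lemma ext_lt_gt0 (R : realFieldType) (A : set R) (e : R) :
  convex_subgroup A -> ext_lt A [set e] -> 0 < e.
Proof. by move=> [A0 _ _]; exact. Qed.

Lemma ext_lt_half (R : realFieldType) (A : set R) (e : R) :
  convex_subgroup A -> ext_lt A [set e] -> ext_lt A [set e / 2].
Proof.
move=> cA Ae s _ As ->.
have := Ae _ _ (convex_subgroupD cA As As) erefl; lra.
Qed.

Lemma convex_subgroup_div (R : realFieldType) (h : R) (A : set R) :
  h != 0 -> convex_subgroup A -> convex_subgroup [set x / h | x in A].
Proof.
move=> h0 cA; have [A0 AB Ac] := cA; split; first by exists 0; rewrite ?mul0r.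
  move=> _ _ [x Ax <-] [y Ay <-]; exists (x - y); last by rewrite mulrBl.
  exact: AB.
move=> _ _ z [x Ax <-] [y Ay <-] xz zy; exists (z * h); last by rewrite mulfK.
case: (ltgtP h 0) h0 => // h0 _.
  by apply: (Ac y x) => //; [rewrite -ler_ndivlMr|rewrite -ler_ndivrMr].
by apply: (Ac x y) => //; [rewrite -ler_pdivrMr|rewrite -ler_pdivlMr].
Qed.

(** If some [l / h] escaped [L], then the elements of [h L] would all be smaller
    than [l] in absolute value, and [h L] would be a subset of [L] missing [l]: an
    absorber [h] of [L] outside [K]. *)
Lemma stable_forV (R : realFieldType) (L K : set R) (h l : R) :
  convex_subgroup L -> stable_for L K -> h != 0 -> ~ K h -> L l -> L (l / h).
Proof.
move=> cL LK h0 nKh Ll; apply: contra_notP nKh => nLlh; apply: LK.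
split=> [_ [x Lx <-]|Lsub].
  apply: (convex_subgroup_norm cL Ll); rewrite leNgt; apply/negP => lhx.
  apply: nLlh; apply: (convex_subgroup_norm cL Lx).
  by rewrite normrM normfV ler_pdivrMr ?normr_gt0 // mulrC -normrM ltW.
have [x Lx hx] := Lsub _ Ll.
by apply: nLlh; rewrite -hx mulrC mulKf.
Qed.

(** The neutrix part of an outer limit is an intersection over all limit values:
    as a set of differences it is empty, instead of a group, whenever these
    values have no common point. *)
Definition subgroup_or_empty (R : realFieldType) (A : set R) : Prop :=
  A = set0 \/ convex_subgroup A.

Lemma nmaxr_or_empty (R : realFieldType) (A B : set R) :
  subgroup_or_empty A -> subgroup_or_empty B -> B `<=` nmax A B.
Proof.
move=> [->|cA] [->|cB]; [exact: sub0set| |exact: sub0set|exact: nmaxr].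
by rewrite /nmax asboolT; last exact: sub0set.
Qed.

Lemma subgroup_or_empty_nmax (R : realFieldType) (A B : set R) :
  subgroup_or_empty A -> subgroup_or_empty B -> subgroup_or_empty (nmax A B).
Proof. by rewrite /nmax; case: asboolP. Qed.

(** * External numbers *)

Lemma coset_mem (R : realFieldType) (a z : R) (A : set R) :
  coset a A (a + z) <-> A z.
Proof. by split=> [[x Ax /addrI<-]|Az] //; exists z. Qed.

Lemma external_number_coset (R : ist_model) (alpha : set R) (c : R) :
  external_number alpha -> alpha c ->
  convex_subgroup (npart alpha) /\ alpha = coset c (npart alpha).
Proof.
move=> [b [B [[_ cB _] ->]]] ac; rewrite npart_coset //; split=> //.
exact: coset_eq.
Qed.

Lemma external_number_rep (R : ist_model) (alpha : set R) :
  external_number alpha -> alpha (rep alpha).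
Proof.
move=> [b [B [[_ cB _] ->]]]; apply: xgetPex; exists b; exact: coset_center.
Qed.

(** * Outer limits *)

(** All limit values through a common point are cosets of that point, hence so
    is their intersection. *)
Lemma npart_outer_lim (R : ist_model) (D : set R) (H : R -> set R) (c : R)
    (P : set R) : subgroup_or_empty (npart (outer_lim D H c P)).
Proof.
set O := outer_lim D H c P.
have [[d Od]|nO] := pselect (exists d, O d); last first.
  left; apply/seteqP; split=> // z [x [y [Ox _ _]]]; apply: nO; by exists x.
right; pose K := [set z | O (d + z)].
have Oz alpha : limit_values D H c P alpha ->
    convex_subgroup (npart alpha) /\
    forall z, alpha (d + z) <-> npart alpha z.
  move=> la; have [cA aE] := external_number_coset la.1 (Od _ la).
  by split=> // z; rewrite {1}aE; exact: coset_mem.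
have cK : convex_subgroup K.
  split.
  - by rewrite /K /= addr0.
  - move=> x y Kx Ky alpha la; have [[_ AB _] aE] := Oz _ la.
    by apply/aE/AB; apply/aE; [exact: Kx|exact: Ky].
  - move=> x y z Kx Ky xz zy alpha la; have [[_ _ Ac] aE] := Oz _ la.
    by apply/aE; apply: (Ac x y) => //; apply/aE; [exact: Kx|exact: Ky].
suff -> : O = coset d K by rewrite npart_coset.
apply/seteqP; split=> [z Oz'|_ [z Kz <-]] //.
by exists (z - d); rewrite /K /= addrC subrK.
Qed.

(** Any [eps > 0] outside the neutrix part of the outer limit is outside the
    neutrix part of a single limit value, whose defining property applies to
    [eps] directly. *)
Lemma outer_lim_approx (R : ist_model) (D : set R) (H : R -> set R) (c : R)
    (P : set R) (d eps : R) :
  outer_lim D H c P d -> 0 < eps -> ~ npart (outer_lim D H c P) eps ->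
  exists2 delta : R, ext_lt P [set delta] &
    forall (x q : R) (Q : set R), D x -> ext_lt P [set `|x - c|] ->
      `|x - c| < delta -> convex_subgroup Q -> H x = coset q Q ->
      `|q - d| < eps.
Proof.
move=> Od e0 nOe.
have /existsNP[alpha /not_implyP[la nade]] : ~ outer_lim D H c P (d + eps).
  move=> Ode; apply: nOe; exists (d + eps), d; split=> //.
  by rewrite addrAC subrr add0r.
have [cA aE] := external_number_coset la.1 (Od _ la).
have nAe : ~ npart alpha eps by move=> Ae; apply: nade; rewrite aE; exists eps.
have [delta Pdelta close] := la.2 _ (convex_subgroup_lt cA e0 nAe).
exists delta => // x q Q Dx Px xdelta cQ HxE.
apply: (close x Dx Px xdelta _ eps) => //.
have cM := convex_subgroup_nmax cQ cA.
by rewrite HxE aE ext_subE // ext_absE //; exact: coset_center.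
Qed.

(** * Fermat's argument *)

(** The condition on [L / h] is where stability enters: it turns the lower
    bound [L] for the increments into the same bound for their quotients. *)
Lemma fermat_convex_subgroup (R : realFieldType) (P L : set R) (f : R -> R)
    (c d r : R) :
  convex_subgroup P -> convex_subgroup L ->
  (forall h l : R, ext_lt P [set h] -> L l -> L (l / h)) ->
  ext_lt P [set r] ->
  (forall eps : R, 0 < eps -> ~ L eps ->
     exists2 delta : R, ext_lt P [set delta] &
       forall x : R, ext_lt P [set `|x - c|] -> `|x - c| < delta ->
         `|x - c| < r -> `|(f x - f c) / (x - c) - d| < eps) ->
  (forall x : R, `|x - c| < r -> exists2 l : R, L l & f c + l <= f x) ->
  L d.
Proof.
move=> cP cL stab Pr fd fmin; apply: contrapT => nLd.
have d0 : 0 < `|d|.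
  by rewrite normr_gt0; apply: contra_notN nLd => /eqP->; case: cL.
have d'0 : 0 < `|d| / 2 by lra.
have nLd' : ~ L (`|d| / 2).
  move=> Ld'; apply: nLd; apply: (convex_subgroup_norm cL).
    exact: (convex_subgroupD cL Ld' Ld').
  by rewrite -splitr normr_id.
have [delta Pdelta close] := fd _ d'0 nLd'.
(* Half of a bound on [P] still exceeds [P]; halving makes [h] strictly
   smaller than both radii. *)
pose h := Num.min delta r / 2.
have Ph : ext_lt P [set h].
  by apply: ext_lt_half => //; rewrite /Num.min; case: ifP.
have h0 := ext_lt_gt0 cP Ph.
have [hdelta hr] : h < delta /\ h < r.
  have dm : Num.min delta r <= delta by rewrite ge_min lexx.
  have rm : Num.min delta r <= r by rewrite ge_min lexx orbT.
  have hh : h + h = Num.min delta r by rewrite -splitr.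
  by split; lra.
(* The step goes in the direction in which a function of slope [d] decreases. *)
have [x [xh slope]] : exists x : R,
    `|x - c| = h /\ (f x - f c) / h < - (`|d| / 2).
  case: (ltgtP d 0) => [d_lt0|d_gt0|d_eq0]; last by move: d0; rewrite d_eq0 normr0 ltxx.
    have nh : `|c + h - c| = h by rewrite addrAC subrr add0r gtr0_norm.
    exists (c + h); split=> //; have := close (c + h).
    rewrite nh => /(_ Ph hdelta hr); rewrite [c + h - c]addrAC subrr add0r.
    by rewrite (ltr0_norm d_lt0) ltr_norml => /andP[]; lra.
  have nh : `|c - h - c| = h by rewrite addrAC subrr add0r normrN gtr0_norm.
  exists (c - h); split=> //; have := close (c - h).
  rewrite nh => /(_ Ph hdelta hr); rewrite [c - h - c]addrAC subrr add0r.
  by rewrite invrN mulrN (gtr0_norm d_gt0) ltr_norml => /andP[]; lra.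
have [l Ll fl] := fmin x ltac:(by rewrite xh).
apply: nLd'; apply: (convex_subgroup_norm cL (stab _ _ Ph Ll)).
have lh : l / h < - (`|d| / 2).
  by apply: le_lt_trans slope; rewrite ler_pM2r ?invr_gt0 //; lra.
by rewrite (gtr0_norm d'0) [`|l / h|]ltr0_norm; lra.
Qed.

(** One variable at a time, the values of a flexible function are replaced by
    representatives; a maximizer of [G] is a minimizer of their opposites. *)
Lemma outer_lim_extremum (R : ist_model) (P L K D : set R) (G : R -> set R)
    (c r : R) :
  let O := outer_lim D (fun x => ext_div (ext_sub (G x) (G c)) (x - c)) c P in
  convex_subgroup P -> convex_subgroup L -> stable_for L K -> K `<=` P ->
  ext_lt P [set r] ->
  (forall x : R, `|x - c| < r -> external_number (G x)) ->
  (forall x : R, `|x - c| < r -> x <> c -> D x) ->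
  npart (G c) `<=` L -> npart O `<=` L ->
  (forall x : R, `|x - c| < r -> ext_ge (G x) (ext_add (G c) L)) \/
  (forall x : R, `|x - c| < r -> ext_le (G x) (ext_add (G c) L)) ->
  O `<=` L.
Proof.
move=> O cP cL LK KP Pr eG sD GcL OL extr d Od.
have r0 := ext_lt_gt0 cP Pr.
have cr : `|c - c| < r by rewrite subrr normr0.
pose f x := rep (G x).
have GE x : `|x - c| < r ->
    convex_subgroup (npart (G x)) /\ G x = coset (f x) (npart (G x)).
  move=> xr; apply: external_number_coset; first exact: eG.
  by apply: external_number_rep; exact: eG.
have [cGc GcE] := GE c cr.
have GcLE : ext_add (G c) L = coset (f c) L.
  rewrite -{1}(coset0 L) GcE.
  by rewrite ext_addE // addr0 /nmax asboolT.
have stab h l : ext_lt P [set h] -> L l -> L (l / h).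
  move=> Ph; apply: (stable_forV cL LK).
    by rewrite gt_eqF //; exact: ext_lt_gt0 Ph.
  by move=> /KP Pnh; have := Ph h h Pnh erefl; rewrite ltxx.
have approx eps : 0 < eps -> ~ L eps ->
    exists2 delta : R, ext_lt P [set delta] &
      forall x : R, ext_lt P [set `|x - c|] -> `|x - c| < delta ->
        `|x - c| < r -> `|(f x - f c) / (x - c) - d| < eps.
  move=> e0 nLe; have nOe : ~ npart O eps by move=> /OL.
  have [delta Pdelta close] := outer_lim_approx Od e0 nOe.
  exists delta => // x Px xdelta xr; have [cGx GxE] := GE x xr.
  have xc : x - c != 0 by rewrite -normr_gt0; exact: ext_lt_gt0 Px.
  have cM := convex_subgroup_nmax cGx cGc.
  apply: (close x _ [set z / (x - c) | z in nmax (npart (G x)) (npart (G c))])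
      => //.
  - by apply: sD => // xE; move: xc; rewrite xE subrr eqxx.
  - exact: convex_subgroup_div.
  - by rewrite {1}GxE {1}GcE ext_subE // ext_divE.
have Gf x : `|x - c| < r -> G x (f x).
  by move=> xr; apply: external_number_rep; exact: eG.
case: extr => [Gmin|Gmax].
  apply: (fermat_convex_subgroup cP cL stab Pr approx) => x xr.
  have := Gmin x xr _ (Gf x xr); rewrite GcLE => -[_ [l Ll <-] le].
  by exists l.
rewrite -[d]opprK; apply: convex_subgroupN => //.
apply: (fermat_convex_subgroup (f := fun x => - f x) cP cL stab Pr).
  move=> eps e0 nLe; have [delta Pdelta close] := approx _ e0 nLe.
  exists delta => // x Px xdelta xr.
  by rewrite -opprD mulNr -opprD normrN; exact: close.
move=> x xr.
have := Gmax x xr _ (Gf x xr); rewrite GcLE => -[_ [l Ll <-] le].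
by exists (- l); [exact: convex_subgroupN|rewrite -opprD lerN2].
Qed.

Lemma nbhd_segments (R : ist_model) (M1 M2 : set R) (a : R * R)
    (U : set (R * R)) :
  convex_subgroup M1 -> convex_subgroup M2 -> nbhd M1 M2 a U ->
  (exists2 r : R, ext_lt M1 [set r] &
     forall x : R, `|x - a.1| < r -> U (x, a.2)) /\
  (exists2 r : R, ext_lt M2 [set r] &
     forall y : R, `|y - a.2| < r -> U (a.1, y)).
Proof.
move=> cM1 cM2 [_ [r1 [r2 [Mr1 Mr2 sU]]]].
have r10 := ext_lt_gt0 cM1 Mr1; have r20 := ext_lt_gt0 cM2 Mr2.
split; [exists r1|exists r2] => // x; rewrite ltr_norml => /andP[xl xr];
  by apply: sU => /=; apply/andP; split; lra.
Qed.

Lemma nmin_subl (R : realFieldType) (A B : set R) :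
  convex_subgroup A -> convex_subgroup B -> nmin A B `<=` A.
Proof.
move=> cA cB; have := nmaxr cA cB; rewrite /nmin /nmax.
by case: asboolP => [_ _|_ BA]; [exact: subset_refl|exact: BA].
Qed.

Lemma nmin_subr (R : realFieldType) (A B : set R) : nmin A B `<=` B.
Proof.
by rewrite /nmin; case: asboolP => [AB|_]; [exact: AB|exact: subset_refl].
Qed.

Theorem theorem7p3 (R : ist_model) (M1 M2 : set R)
  (hM1 : neutrix M1) (hM2 : neutrix M2)
  (X : set (R * R)) (hX : external2 X)
  (a : R * R) (haX : X a) (ha : interior_point M1 M2 X a)
  (F : R * R -> set R) (hF : flexible X F)
  (hd1 : partial_differentiable1 M1 X F a)
  (hd2 : partial_differentiable2 M2 X F a)
  (L : set R) (hL : neutrix L)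
  (hLstable : stable_for L (nmin M1 M2))
  (hLsup : nmax (nmax (npart (F a)) (npart (partial1 M1 X F a)))
             (npart (partial2 M2 X F a)) `<=` L)
  (hextr : local_extreme_point M1 M2 L X F a) :
  partial1 M1 X F a `<=` L /\ partial2 M2 X F a `<=` L.
Proof.
have [_ cM1 _] := hM1; have [_ cM2 _] := hM2; have [_ cL _] := hL.
have [eF _ _] := hF.
have [cFa _] := external_number_coset (eF a haX) (external_number_rep (eF a haX)).
have sFa : subgroup_or_empty (npart (F a)) by right.
have s1 : subgroup_or_empty (npart (partial1 M1 X F a)).
  exact: npart_outer_lim.
have s2 : subgroup_or_empty (npart (partial2 M2 X F a)).
  exact: npart_outer_lim.
have FaL : npart (F a) `<=` L.
  exact: subset_trans (subset_trans (@nmaxl _ _ _) (@nmaxl _ _ _)) hLsup.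
have p1L : npart (partial1 M1 X F a) `<=` L.
  apply: subset_trans hLsup; apply: subset_trans (@nmaxl _ _ _).
  exact: nmaxr_or_empty.
have p2L : npart (partial2 M2 X F a) `<=` L.
  apply: subset_trans hLsup; apply: nmaxr_or_empty => //.
  exact: subgroup_or_empty_nmax.
have [U [nU UX Uextr]] : exists U : set (R * R), [/\ nbhd M1 M2 a U, U `<=` X &
    (forall x, U x -> ext_ge (F x) (ext_add (F a) L)) \/
    (forall x, U x -> ext_le (F x) (ext_add (F a) L))].
  case: hextr => -[U [nU UX Uextr]]; exists U; split=> //; first by left.
  by right.
have [[r1 Mr1 U1] [r2 Mr2 U2]] := nbhd_segments cM1 cM2 nU.
case: a haX eF FaL p1L p2L Uextr U1 U2 {ha hd1 hd2 hLsup hextr cFa sFa s1 s2 nU}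
  => a1 a2 /= haX eF FaL p1L p2L Uextr U1 U2.
split.
- apply: (outer_lim_extremum (G := fun x => F (x, a2)) cM1 cL hLstable
      (nmin_subl cM1 cM2) Mr1) => //.
  + by move=> x xr; apply/eF/UX/U1.
  + by move=> x xr xa; split=> //; apply/UX/U1.
  + by case: Uextr => Uextr; [left|right] => x xr; apply/Uextr/U1.
- apply: (outer_lim_extremum (G := fun y => F (a1, y)) cM2 cL hLstable
      (@nmin_subr _ M1 M2) Mr2) => //.
  + by move=> x xr; apply/eF/UX/U2.
  + by move=> x xr xa; split=> //; apply/UX/U2.
  + by case: Uextr => Uextr; [left|right] => x xr; apply/Uextr/U2.
Qed.
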